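(* Let $d$ be an integer greater than $1$. Then $d \leq \beta^d(d+1) \leq d+1$. Moreover, $\beta^{d}(d+1) = d+1$ when $d$ is even.
   Context: Two vectors $A,B\in\mathbb{R}^n$ are trivially orthogonal if for every coordinate $i\in[n]$ at least one of $A(i)$, $B(i)$ is zero; they are non-trivially orthogonal if they are orthogonal (inner product $0$) but not trivially orthogonal. For $2\le d\le n$, the trivial points of $\{0,1\}^n$ are the all-zero vector and the $n$ unit vectors, together with the all-ones vector when $d$ is odd. $\beta^d(n)$ is the minimum cardinality of a set $\mathcal{V}$ of vectors in $\{-1,0,1\}^n$, each having exactly $d$ non-zero entries, such that every non-trivial point $A\in\{0,1\}^n$ has some $V\in\mathcal{V}$ non-trivially orthogonal to $A$. Here $n=d+1$. *)

(* Defs.v *)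
From HB Require Import structures.
From mathcomp Require Import all_boot all_order all_algebra.

Set Implicit Arguments.
Unset Strict Implicit.
Unset Printing Implicit Defensive.

Import Order.TTheory GRing.Theory Num.Theory.

Local Open Scope ring_scope.

Definition trivially_orthogonal (R : pzRingType) (n : nat) (A B : 'rV[R]_n) :
  bool := [forall i, (A 0 i == 0) || (B 0 i == 0)].

Definition orthogonal (R : pzRingType) (n : nat) (A B : 'rV[R]_n) : bool :=
  \sum_(i < n) A 0 i * B 0 i == 0.

Definition nontrivially_orthogonal (R : pzRingType) (n : nat)
  (A B : 'rV[R]_n) : bool := orthogonal A B && ~~ trivially_orthogonal A B.

Definition trivial_point (R : pzRingType) (d n : nat) (A : 'rV[R]_n) : bool :=
  [|| A == 0, [exists i, A == delta_mx 0 i] | odd d && (A == const_mx 1)].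

(* The finite set s^n of vectors with all entries in the list s of integers,
   as a finite type. *)
Definition cube (s : seq int) (n : nat) := 'rV[seq_sub s]_n.

Definition cube_vec (s : seq int) (n : nat) (v : cube s n) : 'rV[int]_n :=
  map_mx (@ssval _ s) v.

Definition weight (n : nat) (v : 'rV[int]_n) : nat := #|[set i | v 0 i != 0]|.

Definition admissible (d n : nat) (V : {set cube [:: -1; 0; 1] n}) : bool :=
  [forall v in V, weight (cube_vec v) == d] &&
  [forall A : cube [:: 0; 1] n, ~~ trivial_point d (cube_vec A) ==>
    [exists v in V, nontrivially_orthogonal (cube_vec A) (cube_vec v)]].

(* Admissibility is inherited by larger families of vectors of weight d, so the
   seed of the arg min, the family of all of them, is admissible as soon as some
   family is; see betaP.  If no family is admissible (as when d = n > 3),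
   the value has no meaning. *)
Definition beta (d n : nat) : nat :=
  #|[arg min_(V < [set v : cube [:: -1; 0; 1] n | weight (cube_vec v) == d]
      | admissible d V) #|V|]|.

Lemma betaP (d n : nat) (V0 : {set cube [:: -1; 0; 1] n}) :
  admissible d V0 ->
  (exists2 V : {set cube [:: -1; 0; 1] n}, admissible d V & #|V| = beta d n) /\
  (forall V : {set cube [:: -1; 0; 1] n}, admissible d V -> (beta d n <= #|V|)%N).
Proof.
case/andP=> /forall_inP wV0 /forallP hV0; rewrite /beta.
case: arg_minnP => [|V aV minV]; last by split; [exists V | exact: minV].
apply/andP; split; first by apply/forall_inP => v; rewrite inE.
apply/forallP => A; apply/implyP => ntA.
have /exists_inP[v vV0 vA] := implyP (hV0 A) ntA.
by apply/exists_inP; exists v => //; rewrite inE wV0.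
Qed.

(* Main.v *)
(** A vector [v] of weight [d] in dimension [d.+1] has exactly one zero.
    Lower bound: if [v] is orthogonal to the indicator of the complement of [J],
    then the support of [v] meets that complement in an even number of
    coordinates; when [#|J|] and [d] have opposite parities, the support cannot
    contain [J], so the zero of [v] lies in [J].  Singletons [J] (for [d] even)
    show that every coordinate is the zero of some vector of an admissible
    family, and pairs [J] (for [d] odd) that all coordinates but one are.
    Upper bound: let [m] be the odd one among [d] and [d.+1].  The vectors with
    entries [(-1)^j sgn(k - j)] for [j < m], and [- (-1)^k] in the extra
    coordinate when [m = d], for [k < m], form an admissible family.  With [f k]
    the alternating sum of the first [k] coordinates of a point, the inner
    product over the first [m] coordinates is [f k + f k.+1 - f m], and a
    suitable [k] is found by a discrete intermediate value argument on [f], which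
    moves by steps of at most 1 from 0 to [f m]. *)

Require Import Defs.
From HB Require Import structures.
From mathcomp Require Import all_boot all_order all_algebra.
From mathcomp Require Import zify ring.

Set Implicit Arguments.
Unset Strict Implicit.
Unset Printing Implicit Defensive.

Import Order.TTheory GRing.Theory Num.Theory.

Local Open Scope ring_scope.

(** * Discrete intermediate values for alternating sums *)

Lemma pred_switch (p : pred nat) (m : nat) :
  p 0%N != p m -> exists2 k, (k < m)%N & p k != p k.+1.
Proof.
elim: m => [|m IHm]; first by rewrite eqxx.
have [<- /IHm[k km pk] | pm _] := eqVneq (p m) (p m.+1).
  by exists k => //; apply: ltnW.
by exists m.
Qed.

Definition altsum (b : pred nat) (k : nat) : int :=
  \sum_(j < k) (-1) ^+ j *+ b j.

Lemma altsum0 (b : pred nat) : altsum b 0 = 0.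
Proof. by rewrite /altsum big_ord0. Qed.

Lemma altsumS (b : pred nat) (k : nat) :
  altsum b k.+1 = altsum b k + (-1) ^+ k *+ b k.
Proof. by rewrite /altsum big_ord_recr. Qed.

Lemma altsum_step (b : pred nat) (k : nat) :
  `|altsum b k.+1 - altsum b k| <= 1.
Proof.
by rewrite altsumS addrC addKr; case: (b k); rewrite ?mulr0n ?normr0 // normr_sign.
Qed.

Lemma altsumC (b : pred nat) (k : nat) :
  altsum (predC b) k = (odd k)%:R - altsum b k.
Proof.
elim: k => [|k IHk]; first by rewrite !altsum0.
rewrite !altsumS IHk -signr_odd /=.
by case: (odd k); case: (b k) => /=; ring.
Qed.

Lemma altsum_constF (b : pred nat) (m j : nat) (c : int) :
  (forall k, (k <= m)%N -> altsum b k = c) -> (j < m)%N -> b j = false.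
Proof.
move=> bc jm; have := altsumS b j; rewrite !bc ?(ltnW jm) //.
case: (b j) => // /eqP; rewrite mulr1n -signr_odd.
by case: (odd j) => /=; lia.
Qed.

(** Exactly one of 0 and [2 * u + 1] is at most [u], so the sums cross somewhere between [u] and
    [u + 1]; as steps are at most 1, the two values there are exactly these. *)
Lemma altsum_cross_odd (b : pred nat) (m : nat) (u : int) :
  altsum b m = 2 * u + 1 ->
  exists2 k, (k < m)%N & altsum b k + altsum b k.+1 = altsum b m.
Proof.
move=> bm; have [|k km pk] := @pred_switch (fun k => altsum b k <= u) m.
  rewrite altsum0 bm; lia.
exists k => //; move: pk (altsum_step b k); rewrite bm; lia.
Qed.

Lemma altsum_cross_even (b : pred nat) (m : nat) (w : int) :
  altsum b m = 2 * w -> exists2 k, (k <= m)%N & altsum b k = w.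
Proof.
move=> bm; have [w0|w0] := eqVneq w 0; first by exists 0%N; rewrite // altsum0.
have [|k km pk] := @pred_switch (fun k => altsum b k < w) m.
  rewrite altsum0 bm; lia.
have [bk|bk] := eqVneq (altsum b k) w; first by exists k => //; apply: ltnW.
exists k.+1 => //; move: pk bk (altsum_step b k); lia.
Qed.

(** If the sums never left [w] once there, they would end at [w = 2 * w], so [w = 0]; they would
    then stay at their initial value 0, which [b j] forbids. *)
Lemma altsum_depart (b : pred nat) (m j : nat) (w : int) :
  altsum b m = 2 * w -> (j < m)%N -> b j ->
  exists k, [/\ (k < m)%N, altsum b k = w & altsum b k.+1 != w].
Proof.
move=> bm jm bj.
have [/existsP[k /andP[/eqP bk bk1]]|/existsPn nd] := boolP
  [exists k : 'I_m, (altsum b k == w) && (altsum b k.+1 != w)].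
  by exists k; split.
have stay k i : (k + i <= m)%N -> altsum b k = w -> altsum b (k + i) = w.
  elim: i => [|i IHi]; first by rewrite addn0.
  rewrite addnS => lt_m /(IHi (ltnW lt_m)) bki.
  by have := nd (Ordinal lt_m); rewrite /= bki eqxx negbK => /eqP.
have [k km bk] := altsum_cross_even bm.
have w0 : w = 0.
  by have := stay k (m - k)%N; rewrite subnKC // bm => /(_ (leqnn _) bk); lia.
suff c i : (i <= m)%N -> altsum b i = w by rewrite (altsum_constF c jm) in bj.
by move=> im; apply: (stay 0%N i); rewrite // altsum0 w0.
Qed.

(** The same argument run backwards: without an arrival, the value [w] propagates down to index 0,
    so [w = 0], and then from [m] down to every index. *)
Lemma altsum_arrive (b : pred nat) (m j : nat) (w : int) :
  altsum b m = 2 * w -> (j < m)%N -> b j ->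
  exists k, [/\ (k < m)%N, altsum b k != w & altsum b k.+1 = w].
Proof.
move=> bm jm bj.
have [/existsP[k /andP[bk /eqP bk1]]|/existsPn na] := boolP
  [exists k : 'I_m, (altsum b k != w) && (altsum b k.+1 == w)].
  by exists k; split.
have stay k i : (k + i <= m)%N -> altsum b (k + i) = w -> altsum b k = w.
  elim: i => [|i IHi]; first by rewrite addn0.
  rewrite addnS => lt_m bki; apply: (IHi (ltnW lt_m)).
  by have := na (Ordinal lt_m); rewrite /= bki eqxx andbT negbK => /eqP.
have [k km bk] := altsum_cross_even bm.
have w0 : w = 0 by rewrite -(stay 0%N k km bk) altsum0.
suff c i : (i <= m)%N -> altsum b i = w by rewrite (altsum_constF c jm) in bj.
by move=> im; apply: (stay i (m - i)%N); rewrite subnKC // bm w0.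
Qed.

Lemma int_parity (x : int) : (exists w, x = 2 * w) \/ (exists w, x = 2 * w + 1).
Proof.
have [e|e] := eqVneq (x %% 2)%Z 0.
  by left; exists (x %/ 2)%Z; lia.
by right; exists (x %/ 2)%Z; lia.
Qed.

(* Complementing [b] negates [altsum b k + altsum b k.+1 - altsum b m] when [m]
   is odd, and changes the parity of [altsum b m]. *)
Lemma altsum_mid (b : pred nat) (m : nat) : odd m ->
  exists2 k, (k < m)%N & altsum b k + altsum b k.+1 = altsum b m.
Proof.
move=> m_odd; case: (int_parity (altsum b m)) => [] [w bm]; last first.
  exact: altsum_cross_odd bm.
have [|k km] := @altsum_cross_odd (predC b) m (- w).
  by rewrite altsumC bm m_odd /=; ring.
rewrite !altsumC m_odd oddS => e; exists k => //.
by move: e; case: (odd k) => /=; lia.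
Qed.

(** The sign compensates the extra coordinate. For an even total a departure from its half gives it;
    for an odd total, complementing reverses signs, so an arrival is used instead. *)
Lemma altsum_mid_sign (b : pred nat) (m i j : nat) : odd m ->
  (i < m)%N -> (j < m)%N -> b i -> ~~ b j ->
  exists2 k, (k < m)%N &
    altsum b k + altsum b k.+1 = altsum b m + (-1) ^+ k.
Proof.
move=> m_odd im jm bi bj; case: (int_parity (altsum b m)) => [] [w bm].
  have [k [km bk bk1]] := altsum_depart bm im bi; exists k => //.
  move: bk1; rewrite altsumS bm bk; case: (b k); last by rewrite addr0 eqxx.
  by move=> _; rewrite mulr1n; ring.
have bm' : altsum (predC b) m = 2 * (- w) by rewrite altsumC bm m_odd /=; ring.
have [k [km bk bk1]] := altsum_arrive bm' jm bj; exists k => //.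
move: bk bk1; rewrite !altsumC altsumS bm oddS -signr_odd.
by case: (odd k); case: (b k) => /=; lia.
Qed.

(** * The vectors of the upper bound *)

Definition altvec (d k : nat) : 'rV[int]_d.+1 :=
  \row_j if (j < d + ~~ odd d)%N
         then (-1) ^+ j * ((j < k)%:R - (k < j)%:R) else - (-1) ^+ k.

Lemma sum_altvec (b : pred nat) (m k : nat) : (k < m)%N ->
  \sum_(j < m) (-1) ^+ j * ((j < k)%:R - (k < j)%:R) *+ b j =
  altsum b k + altsum b k.+1 - altsum b m.
Proof.
move=> km; rewrite /altsum; pose F j : int := (-1) ^+ j *+ b j.
(* The factor of [(-1) ^+ j] is the indicator of [j < k] plus that of [j < k.+1] minus 1. *)
rewrite (big_ord_widen m F (ltnW km)) (big_ord_widen m F km) /F.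
rewrite [X in X + _ - _]big_mkcond [X in _ + X - _]big_mkcond /= -big_split -sumrB.
apply: eq_bigr => j _.
rewrite ltnS; case: (b j) => /=; case: ltngtP => _ /=;
  by rewrite ?mulr0n ?mulr1n; ring.
Qed.

Lemma altvec_eq0 (d k : nat) (j : 'I_d.+1) : (k < d + ~~ odd d)%N ->
  (altvec d k 0 j == 0) = (j == k :> nat).
Proof.
move=> km; rewrite mxE; case: ifP => jm.
  by rewrite mulf_eq0 signr_eq0 /=; case: ltngtP.
rewrite oppr_eq0 signr_eq0; apply/esym/eqP => jk.
by rewrite jk km in jm.
Qed.

Lemma altvec_in (d k : nat) (j : 'I_d.+1) :
  altvec d k 0 j \in [:: -1; 0; 1].
Proof.
rewrite mxE -[(-1) ^+ j]signr_odd -[(-1) ^+ k]signr_odd.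
by case: ifP => _; [case: (odd j); case: ltngtP | case: (odd k)].
Qed.

Lemma cube_vec_surj (s : seq int) (n : nat) (v : 'rV[int]_n) :
  (forall i, v 0 i \in s) -> exists c : cube s n, cube_vec c = v.
Proof.
move=> vs; exists (\row_i SeqSub (vs i)).
by apply/rowP=> i; rewrite !mxE.
Qed.

Lemma altvec_orth (d : nat) (A : 'rV[int]_d.+1) (b : pred nat) :
  (1 < d)%N -> (forall i, A 0 i = (b i)%:R) -> ~~ trivial_point d A ->
  exists2 k, (k < d + ~~ odd d)%N & nontrivially_orthogonal A (altvec d k).
Proof.
move=> d1 Ab; rewrite /trivial_point negb_or => /andP[A0].
rewrite negb_or => /andP[/existsPn A1 AT].
have [i bi] : exists i : 'I_d.+1, b i.
  apply/existsP; apply: contraR A0 => /existsPn nb.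
  by apply/eqP/rowP => i; rewrite Ab mxE (negPf (nb i)).
have [j bj ji] : exists2 j : 'I_d.+1, b j & j != i.
  apply/exists_inP; apply: contraR (A1 i) => /exists_inPn nb.
  apply/eqP/rowP => j; rewrite Ab mxE eqxx /=.
  have [->|ji] := eqVneq j i; first by rewrite bi.
  by case: (boolP (b j)) => // /nb; rewrite ji.
(* [altvec d k] vanishes only at [k], so it is non-zero at [i] or at [j]. *)
suff [k km s0] : exists2 k, (k < d + ~~ odd d)%N & Defs.orthogonal A (altvec d k).
  exists k; rewrite // /nontrivially_orthogonal s0 /=.
  apply/negP => /forallP triv; have := triv i; have := triv j.
  rewrite !altvec_eq0 // !Ab bi bj /= => /eqP jk /eqP ik.
  by case/eqP: ji; apply: val_inj; rewrite /= jk ik.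
rewrite /Defs.orthogonal; case: (boolP (odd d)) AT => [d_odd AT|d_even _] /=.
  have dm : (d + ~~ odd d)%N = d by rewrite d_odd addn0.
  have orthE k : (k < d)%N -> \sum_(l < d.+1) A 0 l * altvec d k 0 l =
      altsum b k + altsum b k.+1 - altsum b d - (-1) ^+ k *+ b d.
    move=> kd; rewrite big_ord_recr /= -(sum_altvec _ kd) Ab !mxE /= dm ltnn.
    congr (_ + _); last by rewrite mulr_natl mulNrn.
    by apply: eq_bigr => l _; rewrite Ab mxE /= dm ltn_ord mulr_natl.
  rewrite addn0; case: (boolP (b d)) => bd; last first.
    have [k kd e] := altsum_mid b d_odd; exists k => //.
    by rewrite orthE // e (negPf bd) /= subrr subr0.
  have [i0 i0d bi0] : exists2 i0, (i0 < d)%N & b i0.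
    have [id|id] := ltnP i d; first by exists i.
    exists j => //; have := ltn_ord i; have := ltn_ord j.
    by move: ji; rewrite -val_eqE /=; lia.
  (* Otherwise, as [b d] holds, the point would be all-ones, which is trivial for odd [d]. *)
  have [j0 j0d bj0] : exists2 j0, (j0 < d)%N & ~~ b j0.
    have [/existsP[l nbl]|/existsPn ball] := boolP [exists l : 'I_d, ~~ b l].
      by exists l.
    case/eqP: AT; apply/rowP => l; rewrite Ab mxE.
    have [ld|] := ltnP l d; first by have /negPn -> := ball (Ordinal ld).
    by rewrite leq_eqVlt ltnNge -ltnS ltn_ord orbF => /eqP <-; rewrite bd.
  have [k kd e] := altsum_mid_sign d_odd i0d j0d bi0 bj0; exists k => //.
  by rewrite orthE // e bd mulr1n; apply/eqP; ring.
have m_odd : odd d.+1 by rewrite /= d_even.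
have [k kd e] := altsum_mid b m_odd; exists k; first by rewrite addn1.
rewrite (eq_bigr (fun l : 'I_d.+1 =>
  (-1) ^+ l * ((l < k)%:R - (k < l)%:R) *+ b l)).
  by rewrite sum_altvec // e subrr.
by move=> l _; rewrite Ab mxE d_even addn1 ltn_ord mulr_natl.
Qed.

Lemma cube01E (n : nat) (A : cube [:: 0; 1] n) (i : 'I_n) :
  cube_vec A 0 i = (cube_vec A 0 i != 0)%:R.
Proof.
by have := ssvalP (A 0 i); rewrite !mxE !inE => /orP[] /eqP ->.
Qed.

Lemma altvec_admissible (d : nat) : (1 < d)%N ->
  exists2 V : {set cube [:: -1; 0; 1] d.+1}, admissible d V & (#|V| <= d.+1)%N.
Proof.
move=> d1; set m := (d + ~~ odd d)%N.
have [c cE] := fin_all_exists (fun k : 'I_m => cube_vec_surj (@altvec_in d k)).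
exists [set c k | k : 'I_m]; last first.
  apply: leq_trans (leq_imset_card _ _) _; rewrite card_ord -addn1 leq_add2l.
  exact: leq_b1.
apply/andP; split.
  apply/forall_inP => _ /imsetP[k _ ->]; rewrite cE /weight.
  have kd : (k < d.+1)%N.
    by apply: leq_trans (ltn_ord k) _; rewrite -addn1 leq_add2l leq_b1.
  rewrite (_ : [set i | _] = [set~ Ordinal kd]); last first.
    by apply/setP=> i; rewrite !inE altvec_eq0 // -val_eqE.
  by rewrite cardsC1 card_ord.
apply/forallP => A; apply/implyP => ntA.
pose b j := cube_vec A 0 (inord j) != 0.
have [|k km orthk] := altvec_orth (b := b) d1 _ ntA.
  by move=> i; rewrite /b inord_val -cube01E.
apply/exists_inP; exists (c (Ordinal km)); first exact: imset_f.
by rewrite cE.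
Qed.

(** * Lower bound by parity *)

(** Modulo 2 every non-zero term of the inner product is 1. *)
Lemma orthogonal_even (n : nat) (A v : 'rV[int]_n) :
  (forall i, A 0 i \in [:: 0; 1]) -> (forall i, v 0 i \in [:: -1; 0; 1]) ->
  Defs.orthogonal A v -> ~~ odd #|[set i | (A 0 i != 0) && (v 0 i != 0)]|.
Proof.
move=> A01 v11 /eqP /(congr1 (fun x : int => x%:~R : 'F_2)).
set S := [set i | _]; rewrite rmorph_sum /=.
rewrite (eq_bigr (fun i => (if i \in S then 1 else 0)%:R)).
  rewrite -natr_sum -big_mkcond sum1_card => /eqP.
  by rewrite -(dvdn_pcharf (pchar_Fp (isT : prime 2))) dvdn2.
move=> i _; have := A01 i; have := v11 i; rewrite !inE.
by move=> /or3P[] /eqP -> /orP[] /eqP ->; apply/eqP.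
Qed.

Lemma admissible_zero (d : nat) (V : {set cube [:: -1; 0; 1] d.+1})
    (J : {set 'I_d.+1}) :
  admissible d V -> J != set0 -> (1 < #|~: J|)%N -> odd #|J| != odd d ->
  exists2 j, j \in J & [exists v in V, cube_vec v 0 j == 0].
Proof.
move=> /andP[/forall_inP wV /forallP hV] J0 J1 Jodd.
have [|A AE] := @cube_vec_surj [:: 0; 1] _ (\row_i (i \notin J)%:R : 'rV[int]_d.+1).
  by move=> i; rewrite mxE; case: (i \notin J).
(* Two elements outside [J] exclude the zero and unit vectors; an element of [J] excludes the
   all-ones vector. *)
have : ~~ trivial_point d (cube_vec A).
  rewrite AE /trivial_point !negb_or; apply/and3P; split.
  - have /card_gt0P[i iJ] := ltnW J1; apply/eqP => /rowP/(_ i)/eqP.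
    by rewrite !mxE -in_setC iJ.
  - apply/existsPn => i; apply/eqP => /rowP Ai; move: J1; apply/negP.
    rewrite -leqNgt -(cards1 i); apply/subset_leq_card/subsetP => j.
    by rewrite !inE => jJ; have := Ai j; rewrite !mxE jJ eqxx /=; case: (j == i).
  - rewrite negb_and; apply/orP; right; have [j jJ] := set0Pn _ J0.
    by apply/eqP => /rowP/(_ j)/eqP; rewrite !mxE jJ.
have := hV A => /implyP h /h /exists_inP[v vV /andP[orth _]].
have := orthogonal_even _ _ orth.
have v11 i : cube_vec v 0 i \in [:: -1; 0; 1] by rewrite mxE; apply: ssvalP.
move=> /(_ _ v11) ev; set N := [set i | cube_vec v 0 i != 0].
have cN : #|N| = d by apply/eqP/(wV v vV).
have {}ev : ~~ odd #|N :\: J|.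
  have A01 i : cube_vec A 0 i \in [:: 0; 1] by rewrite mxE; apply: ssvalP.
  have := ev A01; congr (~~ odd #|pred_of_set _|); apply/setP => i.
  by rewrite !inE AE mxE; case: (i \in J).
suff /subsetPn[j jJ] : ~~ (J \subset N).
  by rewrite inE negbK => vj; exists j => //; apply/exists_inP; exists v.
apply: contra Jodd => /setIidPr JN.
by rewrite -[in odd d]cN -(cardsID J N) JN oddD (negPf ev) addbF.
Qed.

Lemma card_zeros (d : nat) (V : {set cube [:: -1; 0; 1] d.+1}) :
  admissible d V ->
  (#|[set j | [exists v in V, (cube_vec v 0 j == 0)%R]]| <= #|V|)%N.
Proof.
move=> /andP[/forall_inP wV _]; set Z := [set j | _].
pose zero (v : cube [:: -1; 0; 1] d.+1) :=
  odflt ord0 [pick j | cube_vec v 0 j == 0].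
apply: leq_trans (leq_imset_card zero V).
apply/subset_leq_card/subsetP => j; rewrite inE => /exists_inP[v vV vj].
apply/imsetP; exists v => //; rewrite /zero; case: pickP => [i vi|/(_ j)]; last first.
  by rewrite vj.
pose N := [set i | cube_vec v 0 i != 0].
have /eqP/cards1P[l Nl] : #|~: N| = 1%N.
  have /eqP := wV v vV; have := cardsC N; rewrite card_ord /weight -/N; lia.
have: i \in [set l] by rewrite -Nl !inE negbK.
have: j \in [set l] by rewrite -Nl !inE negbK.
by rewrite !inE => /eqP -> /eqP ->.
Qed.

Local Close Scope ring_scope.

Theorem theorem3 (d : nat) (hd : 1 < d) :
  d <= beta d d.+1 <= d.+1 /\ (~~ odd d -> beta d d.+1 = d.+1).
Proof.
have [V0 aV0 cV0] := altvec_admissible hd.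
have [[V aV <-] minV] := betaP aV0.
have leV : #|V| <= d.+1 by apply: leq_trans (minV V0 aV0) cV0.
have := card_zeros aV; set Z := [set j | _] => leZ.
have hitZ J : J != set0 -> 1 < #|~: J| -> odd #|J| != odd d ->
    ~~ (J \subset ~: Z).
  move=> J0 J1 Jd; have [j jJ vj] := admissible_zero aV J0 J1 Jd.
  by apply/subsetPn; exists j => //; rewrite !inE negbK.
have cardZ : #|Z| + #|~: Z| = d.+1 by rewrite cardsC card_ord.
have [d_odd|d_even] := boolP (odd d).
  split=> //; rewrite leV andbT; apply: leq_trans leZ.
  suff : #|~: Z| <= 1 by move: cardZ; lia.
  rewrite leqNgt; apply/negP => /card_gt1P[j [k [jZ kZ jk]]].
  have cJ : #|[set j; k]| = 2 by rewrite cards2 jk.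
  apply: (negP (hitZ [set j; k] _ _ _)); rewrite ?cJ ?d_odd //.
  - by rewrite -card_gt0 cJ.
  (* An odd [d > 1] is at least 3, so [d - 1 >= 2] coordinates lie outside the pair. *)
  - by have := cardsC [set j; k]; rewrite cJ card_ord; move: hd d_odd; lia.
  - by apply/subsetP => i; rewrite in_set2 => /orP[] /eqP ->.
suff Z0 : ~: Z = set0.
  have -> : #|V| = d.+1 by move: leZ leV; rewrite Z0 cards0 in cardZ; lia.
  by rewrite leqnn leqnSn.
apply/eqP; rewrite -subset0; apply/subsetP => j jZ.
case: (negP (hitZ [set j] _ _ _)); rewrite ?cards1 ?sub1set //.
- by rewrite -card_gt0 cards1.
- by rewrite cardsC1 card_ord.
Qed.
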